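(* Let $\Lambda$ be a left hereditary ring and $f:A\rightarrow B$ a homomorphism of $\Lambda$-modules. The following are equivalent: (1) $\underline{f}$ is an isomorphism in the stable category $\Lambda\text{-}\underline{\mathrm{Mod}}$; (2) $\mathrm{Ker}\, f$ is a projective direct summand of $A$, and there is a decomposition $B=M\oplus Q$ into submodules with $Q$ projective and $M\subset f(A)$.
   Context: Rings are associative with identity; modules are left modules. The stable category $\Lambda\text{-}\underline{\mathrm{Mod}}$ has all left $\Lambda$-modules as objects; its morphisms are classes $\underline{f}$ of $\Lambda$-homomorphisms $f$, where $f$ and $g$ are equivalent if $f-g$ factors through a projective module. The symbol $\subset$ denotes non-strict containment. *)

(* Defs.v *)
From HB Require Import structures.
From mathcomp Require Import all_boot all_algebra boolp.

Set Implicit Arguments.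
Unset Strict Implicit.
Unset Printing Implicit Defensive.

Import GRing.Theory.
Local Open Scope ring_scope.
Local Open Scope quotient_scope.

(* Rings are [pzRingType], so the zero ring is allowed.  Submodules of [V] are
   [submodClosed V], that is Boolean predicates; under the classical axioms of
   [boolp] these are all the submodules. *)

(* A submodule regarded as a module. *)
Section Submodule.
Variables (R : pzRingType) (V : lmodType R) (S : submodClosed V).

Record submodule := Submodule { submodule_val : V; _ : submodule_val \in S }.

HB.instance Definition _ := [isSub for submodule_val].
HB.instance Definition _ := [Choice of submodule by <:].
HB.instance Definition _ := [SubChoice_isSubLmodule of submodule by <:].
End Submodule.

Section Kernel.
Variables (R : pzRingType) (A B : lmodType R) (f : {linear A -> B}).

Definition ker : {pred A} := [pred x | f x == 0].

Fact ker_submod_closed : submod_closed ker.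
Proof.
split=> [|a x y]; rewrite !inE ?linear0 // => /eqP fx /eqP fy.
by rewrite linearP fx fy scaler0 addr0.
Qed.

HB.instance Definition _ := GRing.isSubmodClosed.Build R A ker ker_submod_closed.
End Kernel.

(* [V] is the internal direct sum of [M] and [N]. *)
Definition direct_sum (R : pzRingType) (V : lmodType R) (M N : submodClosed V) :=
  (forall x : V, exists m n, [/\ m \in M, n \in N & x = m + n]) /\
  (forall x : V, x \in M -> x \in N -> x = 0).

Definition direct_summand (R : pzRingType) (V : lmodType R) (M : submodClosed V) :=
  exists N : submodClosed V, direct_sum M N.

Definition projective (R : pzRingType) (P : lmodType R) :=
  forall (M N : lmodType R) (g : {linear M -> N}) (h : {linear P -> N}),
    (forall y, exists x, g x = y) ->
    exists k : {linear P -> M}, forall x, g (k x) = h x.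

(* Left ideals of [R] are the submodules of the left regular module [R^o]. *)
Definition left_hereditary (R : pzRingType) :=
  forall I : submodClosed R^o, projective (submodule I).

Fact projective_regular (R : pzRingType) : projective R^o.
Proof.
move=> M N g h g_surj; have [x gx] := g_surj (h 1).
have linx : linear (fun a : R^o => a *: x).
  by move=> a b c; rewrite scalerDl scalerA.
pose kL := GRing.isLinear.Build _ _ _ _ _ linx.
pose k : {linear R^o -> M} := HB.pack (fun a : R^o => a *: x) kL.
exists k => a; rewrite -[k a]/(a *: x) linearZ gx -linearZ.
by congr (h _); exact: mulr1.
Qed.

Fact projective_prod (R : pzRingType) (P Q : lmodType R) :
  projective P -> projective Q -> projective (P * Q)%type.
Proof.
move=> projP projQ M N g h g_surj.
have linl : linear (fun x : P => h (x, 0)).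
  move=> a x y; rewrite -linearP; congr (h _).
  by congr (_, _); rewrite /= scaler0 addr0.
have linr : linear (fun y : Q => h (0, y)).
  move=> a x y; rewrite -linearP; congr (h _).
  by congr (_, _); rewrite /= scaler0 addr0.
pose hl : {linear P -> N} :=
  HB.pack (fun x => h (x, 0)) (GRing.isLinear.Build _ _ _ _ _ linl).
pose hr : {linear Q -> N} :=
  HB.pack (fun y => h (0, y)) (GRing.isLinear.Build _ _ _ _ _ linr).
have [k gk] := projP _ _ g hl g_surj; have [l gl] := projQ _ _ g hr g_surj.
have link : linear (fun z : P * Q => k z.1 + l z.2).
  by move=> a x y; rewrite /= !linearP scalerDr addrACA.
pose kl : {linear (P * Q)%type -> M} :=
  HB.pack (fun z : P * Q => k z.1 + l z.2)
    (GRing.isLinear.Build _ _ _ _ _ link).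
exists kl => -[x y]; rewrite -[kl _]/(k x + l y) linearD gk gl.
rewrite -[hl x]/(h (x, 0)) -[hr y]/(h (0, y)) -linearD.
by congr (h _); congr (_, _); rewrite /= ?addr0 ?add0r.
Qed.

Section StableEquivalence.
Variables (R : pzRingType) (A B : lmodType R).

Definition factors_through_projective (f : A -> B) :=
  exists (P : lmodType R) (u : {linear A -> P}) (v : {linear P -> B}),
    projective P /\ forall x, f x = v (u x).

Definition stable_equiv (f g : {linear A -> B}) :=
  factors_through_projective (f \- g).

Fact stable_equiv_refl f : stable_equiv f f.
Proof.
exists R^o, \0, \0; split; first exact: projective_regular.
by move=> x; rewrite /= subrr.
Qed.

Fact stable_equiv_sym f g : stable_equiv f g -> stable_equiv g f.
Proof.
move=> [P [u [v [projP fE]]]]; exists P, u, (\- v); split=> // x.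
by rewrite /= -fE /= opprB.
Qed.

Fact stable_equiv_trans g f h :
  stable_equiv f g -> stable_equiv g h -> stable_equiv f h.
Proof.
move=> [P [u [v [projP fE]]]] [Q [u' [v' [projQ gE]]]].
have linu : linear (fun x => (u x, u' x)).
  by move=> a x y; rewrite !linearP.
have linv : linear (fun z : P * Q => v z.1 + v' z.2).
  by move=> a x y; rewrite /= !linearP scalerDr addrACA.
pose w : {linear A -> (P * Q)%type} :=
  HB.pack (fun x => (u x, u' x)) (GRing.isLinear.Build _ _ _ _ _ linu).
pose w' : {linear (P * Q)%type -> B} :=
  HB.pack (fun z : P * Q => v z.1 + v' z.2)
    (GRing.isLinear.Build _ _ _ _ _ linv).
exists (P * Q)%type, w, w'; split; first exact: projective_prod.
by move=> x; rewrite -[w' _]/(v (u x) + v' (u' x)) -fE -gE /= addrA subrK.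
Qed.

Definition stable_equivb (f g : {linear A -> B}) : bool := `[<stable_equiv f g>].

Fact stable_equivb_equiv : equiv_class_of stable_equivb.
Proof.
split=> [f|f g|g f h].
- exact/asboolP/stable_equiv_refl.
- by apply/asboolP/asboolP; exact: stable_equiv_sym.
- by move=> /asboolP fg /asboolP gh; exact/asboolP/(stable_equiv_trans fg).
Qed.

Canonical stable_equiv_rel := EquivRelPack stable_equivb_equiv.

End StableEquivalence.

HB.instance Definition _ (R : pzRingType) (A B : lmodType R) :=
  gen_eqMixin {linear A -> B}.
HB.instance Definition _ (R : pzRingType) (A B : lmodType R) :=
  gen_choiceMixin {linear A -> B}.

(* The stable category: objects are the modules, morphisms from [A] to [B] are
   the elements of [stable_hom A B]. *)
Definition stable_hom (R : pzRingType) (A B : lmodType R) :=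
  {eq_quot (@stable_equiv_rel R A B)}.

Definition stable_class (R : pzRingType) (A B : lmodType R)
  (f : {linear A -> B}) : stable_hom A B := \pi f.

Definition stable_id (R : pzRingType) (A : lmodType R) : stable_hom A A :=
  stable_class idfun.

Definition stable_comp (R : pzRingType) (A B C : lmodType R)
    (v : stable_hom B C) (u : stable_hom A B) : stable_hom A C :=
  stable_class (repr v \o repr u).

Lemma stable_classP (R : pzRingType) (A B : lmodType R) (f g : {linear A -> B}) :
  stable_class f = stable_class g <-> stable_equiv f g.
Proof. by split=> [/eqmodP/asboolP //|fg]; apply/eqmodP/asboolP. Qed.

Lemma stable_reprK (R : pzRingType) (A B : lmodType R) (u : stable_hom A B) :
  stable_class (repr u) = u.
Proof. exact: reprK. Qed.

Lemma stable_compE (R : pzRingType) (A B C : lmodType R)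
    (g : {linear B -> C}) (f : {linear A -> B}) :
  stable_comp (stable_class g) (stable_class f) = stable_class (g \o f).
Proof.
set g' := repr (stable_class g); set f' := repr (stable_class f).
have /stable_classP[P [u [v [projP gE]]]] : stable_class g' = stable_class g.
  exact: stable_reprK.
have /stable_classP[Q [u' [v' [projQ fE]]]] : stable_class f' = stable_class f.
  exact: stable_reprK.
apply/stable_classP; apply: (@stable_equiv_trans _ _ _ (g \o f')).
  by exists P, (u \o f'), v; split=> // x; rewrite /= -gE.
by exists Q, u', (g \o v'); split=> // x; rewrite /= -fE linearB.
Qed.

Lemma stable_compA (R : pzRingType) (A B C D : lmodType R)
    (w : stable_hom C D) (v : stable_hom B C) (u : stable_hom A B) :
  stable_comp w (stable_comp v u) = stable_comp (stable_comp w v) u.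
Proof.
rewrite -(stable_reprK u) -(stable_reprK v) -(stable_reprK w) !stable_compE.
by apply/stable_classP; exact: stable_equiv_refl.
Qed.

Lemma stable_comp1l (R : pzRingType) (A B : lmodType R) (u : stable_hom A B) :
  stable_comp (stable_id B) u = u.
Proof.
rewrite -(stable_reprK u) stable_compE.
by apply/stable_classP; exact: stable_equiv_refl.
Qed.

Lemma stable_comp1r (R : pzRingType) (A B : lmodType R) (u : stable_hom A B) :
  stable_comp u (stable_id A) = u.
Proof.
rewrite -(stable_reprK u) stable_compE.
by apply/stable_classP; exact: stable_equiv_refl.
Qed.

Definition stable_iso (R : pzRingType) (A B : lmodType R) (u : stable_hom A B) :=
  exists v : stable_hom B A,
    stable_comp v u = stable_id A /\ stable_comp u v = stable_id B.

(* Main.v *)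
(** Over a left hereditary ring every submodule of a projective module is
    projective: a projective module embeds in a free one, and a lift is built by
    Zorn's lemma on elements supported in a set of coordinates, the values of one
    further coordinate forming a left ideal, which splits off.

    If 1 - gf = vu factors through P and 1 - fg = ts through P', then ker f is
    embedded in P by u.  The map p |-> (s f v p, p - u v p) from P to P' * P has
    kernel u (ker f) and projective image, so it splits, and composing u, the
    retraction of P onto that kernel, and v retracts A onto ker f.  Likewise
    s : B -> P' splits and its kernel lies in f(A), because b - f g b = t s b.

    Conversely, if A = ker f + N and B = M + Q, let g b be the element of N over
    the M-component of b.  Then 1 - fg is the projection to Q, and the image
    of 1 - gf embeds in ker f * Q. *)

Require Import Defs.
From HB Require Import structures.
From mathcomp Require Import all_boot all_algebra boolp.
From mathcomp Require Import classical_sets functions.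

Set Implicit Arguments.
Unset Strict Implicit.
Unset Printing Implicit Defensive.

Import GRing.Theory.
Local Open Scope ring_scope.

(** * Corestrictions, retracts and images of linear maps *)

Definition linear_of (R : pzRingType) (U V : lmodType R) (f : U -> V)
  (fL : linear f) : {linear U -> V} :=
  HB.pack f (GRing.isLinear.Build _ _ _ _ _ fL).

Lemma corestrict_linear (R : pzRingType) (U V : lmodType R)
    (S : submodClosed V) (f : {linear U -> V}) :
  (forall x, f x \in S) ->
  exists k : {linear U -> submodule S}, forall x, val (k x) = f x.
Proof.
move=> fS; pose k x : submodule S := Submodule (fS x).
have kL : linear k by move=> a x y; apply: val_inj; rewrite /= linearP.
by exists (linear_of kL).
Qed.

Lemma projective_retract (R : pzRingType) (P Q : lmodType R)
    (i : {linear Q -> P}) (r : {linear P -> Q}) :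
  cancel i r -> projective P -> projective Q.
Proof.
move=> irK projP M N g h gS; have [k gk] := projP M N g (h \o r) gS.
by exists (k \o i) => x; rewrite /= gk /= irK.
Qed.

Section Image.
Variables (R : pzRingType) (U V : lmodType R) (f : {linear U -> V}).

Definition im : {pred V} := [pred y | `[<exists x, f x = y>]].

Lemma imP y : reflect (exists x, f x = y) (y \in im).
Proof. exact: asboolP. Qed.

Fact im_submod_closed : submod_closed im.
Proof.
split=> [|a x y /imP[u <-] /imP[v <-]]; apply/imP.
  by exists 0; rewrite linear0.
by exists (a *: u + v); rewrite linearP.
Qed.

HB.instance Definition _ := GRing.isSubmodClosed.Build R V im im_submod_closed.

(** The corestriction of [f] to its image is onto, so lifting the identity of the projective image
    gives a section. *)
Lemma im_split : projective (submodule im) ->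
  exists (p : {linear U -> submodule im}) (s : {linear submodule im -> U}),
    cancel s p /\ forall x, val (p x) = f x.
Proof.
move=> projI; have [|p pE] := corestrict_linear (S := im) (f := f).
  by move=> x; apply/imP; exists x.
have pS y : exists x, p x = y.
  by have /imP[x fx] := valP y; exists x; apply: val_inj; rewrite pE fx.
by have [s ps] := projI _ _ p idfun pS; exists p, s.
Qed.
End Image.

(** * Lifting by Zorn's lemma on modules with finitely supported coordinates *)

Section Coordinates.
Variables (R : pzRingType) (S : lmodType R) (I : eqType).
Variable c : I -> {linear S -> R^o}.

Definition supported_in (J : set I) : {pred S} :=
  [pred x | `[<forall i, c i x != 0 -> J i>]].

Lemma supported_inP (J : set I) x :
  reflect (forall i, c i x != 0 -> J i) (x \in supported_in J).
Proof. exact: asboolP. Qed.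

Fact supported_in_closed (J : set I) : submod_closed (supported_in J).
Proof.
split=> [|a x y /supported_inP xJ /supported_inP yJ]; apply/supported_inP => i.
  by rewrite linear0 eqxx.
rewrite linearP; have [->|] := eqVneq (c i x) 0; last by move=> /xJ.
by rewrite scaler0 add0r => /yJ.
Qed.

HB.instance Definition _ (J : set I) :=
  GRing.isSubmodClosed.Build R S (supported_in J) (supported_in_closed J).

Lemma supported_inS (J K : set I) : (J `<=` K)%classic ->
  {subset supported_in J <= supported_in K}.
Proof. by move=> JK x /supported_inP xJ; apply/supported_inP => i /xJ /JK. Qed.

Lemma supported_in_setU1 (J : set I) i x :
  x \in supported_in (J `|` [set i])%classic -> c i x = 0 -> x \in supported_in J.
Proof.
move=> /supported_inP xJ cx0; apply/supported_inP => j cjx.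
by have [//|ji] := xJ j cjx; move: cjx; rewrite ji cx0 eqxx.
Qed.

Section Lift.
Hypothesis c_fin : forall x, exists s : seq I, forall i, c i x != 0 -> i \in s.
Hypothesis c_inj : forall x, (forall i, c i x = 0) -> x = 0.
Hypothesis hered : left_hereditary R.
Variables (M N : lmodType R) (g : {linear M -> N}) (h : {linear S -> N}).
Hypothesis g_surj : forall y, exists x, g x = y.

(* [pl_fun] is junk outside the elements supported in [pl_dom]. *)
Record partial_lift := PartialLift {
  pl_dom : set I;
  pl_fun : S -> M;
  pl_linear : forall a x y, x \in supported_in pl_dom -> y \in supported_in pl_dom ->
    pl_fun (a *: x + y) = a *: pl_fun x + pl_fun y;
  pl_lift : forall x, x \in supported_in pl_dom -> g (pl_fun x) = h x }.

(** Junk values are not compared, so this is only a preorder; antisymmetry fails. *)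
Definition pl_le (k l : partial_lift) : bool :=
  `[< (pl_dom k `<=` pl_dom l)%classic /\
      forall x, x \in supported_in (pl_dom k) -> pl_fun k x = pl_fun l x >].

Lemma supported_in_set0 x : x \in supported_in set0 -> x = 0.
Proof.
move=> /supported_inP x0; apply: c_inj => i.
by apply/eqP; case: eqP => // /eqP /x0.
Qed.

Fact pl0_linear a x y : x \in supported_in set0 -> y \in supported_in set0 ->
  cst 0 (a *: x + y) = a *: cst 0 x + cst 0 y :> M.
Proof. by rewrite /cst scaler0 addr0. Qed.

Fact pl0_lift x : x \in supported_in set0 -> g (cst 0 x) = h x.
Proof. by move=> /supported_in_set0->; rewrite !linear0. Qed.

Definition pl0 := PartialLift pl0_linear pl0_lift.

Lemma pl_le_refl k : pl_le k k.
Proof. by apply/asboolP; split. Qed.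

Lemma pl_le_trans k l m : pl_le k l -> pl_le l m -> pl_le k m.
Proof.
move=> /asboolP[kl klE] /asboolP[lm lmE]; apply/asboolP.
split=> [i /kl /lm //|x xk]; rewrite klE // lmE //.
exact: supported_inS xk.
Qed.

(** An element supported in the union [J] of the domains has finitely many nonzero coordinates, so a
    single member of the chain already supports it. Members agree where both are meaningful, so they
    glue to a lift on [J]. *)
Lemma pl_chain (C : set partial_lift) : total_on C pl_le ->
  exists l, forall k, C k -> pl_le k l.
Proof.
move=> Ctot; have [C0|Cn0] := pselect (exists k, C k); last first.
  by exists pl0 => k Ck; case: Cn0; exists k.
pose J : set I := (fun i => exists2 k, C k & pl_dom k i).
have supJ (s : seq I) : (forall i, i \in s -> J i) ->
    exists2 k, C k & forall i, i \in s -> pl_dom k i.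
  elim: s => [|i s IHs] sJ; first by have [k Ck] := C0; exists k.
  have [|k Ck ks] := IHs; first by move=> j js; apply: sJ; rewrite inE js orbT.
  have [l Cl li] := sJ i (mem_head i s).
  have [/asboolP[kl _]|/asboolP[lk _]] := Ctot k l Ck Cl.
  - by exists l => // j; rewrite inE => /predU1P[->//|/ks /kl].
  - by exists k => // j; rewrite inE => /predU1P[->|/ks //]; exact: lk.
have memJ x : x \in supported_in J -> exists2 k, C k & x \in supported_in (pl_dom k).
  move=> /supported_inP xJ; have [s xs] := c_fin x.
  (* The list [s] may contain indices outside [J]; only those with a nonzero coordinate are kept. *)
  have [|k Ck ks] := supJ [seq i <- s | c i x != 0].
    by move=> i; rewrite mem_filter => /andP[/xJ].
  exists k => //; apply/supported_inP => i cix; apply: ks.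
  by rewrite mem_filter cix xs.
have memJ2 x y : x \in supported_in J -> y \in supported_in J ->
    exists k, [/\ C k, x \in supported_in (pl_dom k) & y \in supported_in (pl_dom k)].
  move=> /memJ[k Ck xk] /memJ[l Cl yl].
  have [/asboolP[kl _]|/asboolP[lk _]] := Ctot k l Ck Cl.
  - by exists l; split=> //; exact: supported_inS xk.
  - by exists k; split=> //; exact: supported_inS yl.
have /choice[F FE] : forall x, exists m : M,
    forall k, C k -> x \in supported_in (pl_dom k) -> m = pl_fun k x.
  move=> x; have [[k Ck xk]|nx] := pselect (exists2 k, C k & x \in supported_in (pl_dom k)).
    exists (pl_fun k x) => l Cl xl.
    have [/asboolP[_ ->]|/asboolP[_ ->]] // := Ctot k l Ck Cl.
  by exists 0 => k Ck xk; case: nx; exists k.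
have FL a x y : x \in supported_in J -> y \in supported_in J ->
    F (a *: x + y) = a *: F x + F y.
  move=> xJ yJ; have [k [Ck xk yk]] := memJ2 x y xJ yJ.
  rewrite !(FE _ k) //; last by rewrite rpredD // rpredZ.
  exact: pl_linear.
have Fg x : x \in supported_in J -> g (F x) = h x.
  by move=> /memJ[k Ck xk]; rewrite (FE _ k) // pl_lift.
exists (PartialLift FL Fg) => k Ck; apply/asboolP; split=> [i ki|x xk] /=.
  by exists k.
by rewrite (FE _ k).
Qed.

(** The values of [c i] on elements supported in [J] form a left ideal, which is projective, so
    [c i] splits there. Subtracting [s (p x)] kills coordinate [i]: [k] handles the remainder
    [pr x], and a lift [l] on the ideal handles [s (p x)]. *)
Lemma pl_extend (k : partial_lift) i :
  exists l, pl_le k l /\ pl_dom l i.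
Proof.
have [ki|nki] := pselect (pl_dom k i); first by exists k; split=> //; exact: pl_le_refl.
pose J : set I := (pl_dom k `|` [set i])%classic.
have kJ : {subset supported_in (pl_dom k) <= supported_in J}.
  by apply: supported_inS; exact: subsetUl.
pose S' : submodClosed S := supported_in J.
pose ci : {linear submodule S' -> R^o} := c i \o val.
have projI : projective (submodule (im ci)) := @hered (im ci).
have [p [s [psK pE]]] := im_split projI.
have [l gl] := projI _ _ g (h \o val \o s) g_surj.
pose pr (x : submodule S') := val x - val (s (p x)).
have prk x : pr x \in supported_in (pl_dom k).
  apply: (@supported_in_setU1 _ i); first by rewrite rpredB // (valP (_ : submodule S')).
  rewrite linearB -[c i (val x)]/(ci x) -[c i _]/(ci (s (p x))).
  by rewrite -!pE psK subrr.
pose F' (x : submodule S') := pl_fun k (pr x) + l (p x).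
(* [insubd 0] makes [F] total; its default 0 is used only for [x] not supported in [J]. *)
pose F (x : S) := F' (insubd 0 x).
have insE x : x \in supported_in J -> val (insubd (0 : submodule S') x) = x.
  by move=> xJ; rewrite val_insubd xJ.
have FL a x y : x \in supported_in J -> y \in supported_in J ->
    F (a *: x + y) = a *: F x + F y.
  move=> xJ yJ; rewrite /F.
  have -> : insubd (0 : submodule S') (a *: x + y) = a *: insubd 0 x + insubd 0 y.
    apply: val_inj; rewrite insE; last by rewrite rpredD // rpredZ.
    by rewrite linearP /= !insE.
  move: (insubd 0 x) (insubd 0 y) => {x y xJ yJ} x y.
  rewrite /F' !linearP scalerDr addrACA -pl_linear //; congr (pl_fun k _ + _).
  by rewrite /pr !linearP /= scalerDr addrACA.
have Fg x : x \in supported_in J -> g (F x) = h x.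
  move=> xJ; rewrite /F /F' linearD pl_lift // gl /= -linearD.
  by rewrite /pr subrK insE.
exists (PartialLift FL Fg); split; last by right.
apply/asboolP; split=> [j kj|x xk] /=; first by left.
rewrite /F /F' /pr.
(* As [i] is outside the domain of [k], coordinate [i] of [x] vanishes, so [F] extends
   [pl_fun k]. *)
have -> : p (insubd 0 x) = 0.
  apply: val_inj; rewrite pE /= insE ?kJ //.
  by apply/eqP; case: eqP => // /eqP cix; case: nki; move/supported_inP: xk; exact.
by rewrite !linear0 !addr0 insE ?kJ.
Qed.

(** By [pl_extend], the domain of a maximal partial lift contains every index, so every element is
    supported in it. *)
Lemma coordinate_lift : exists k : {linear S -> M}, forall x, g (k x) = h x.
Proof.
have [k kmax] := ZL_preorder pl0 pl_le_refl pl_le_trans pl_chain.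
have kT x : x \in supported_in (pl_dom k).
  apply/supported_inP => i _; have [l [kl li]] := pl_extend k i.
  by have /asboolP[+ _] := kmax l kl; apply.
have kL : linear (pl_fun k) by move=> a x y; rewrite pl_linear.
by exists (linear_of kL) => x; rewrite -[linear_of kL x]/(pl_fun k x) pl_lift.
Qed.
End Lift.

Lemma coordinate_projective :
  (forall x, exists s : seq I, forall i, c i x != 0 -> i \in s) ->
  (forall x, (forall i, c i x = 0) -> x = 0) ->
  left_hereditary R -> projective S.
Proof. by move=> cf ci hered M N g h gS; exact: coordinate_lift. Qed.
End Coordinates.

(** * Free covers, and submodules of projective modules over a hereditary ring *)

Section Free.
Variables (R : pzRingType) (V : lmodType R).

(** As a module, this is the free module with the elements of [V] as basis. *)
Definition fin_supp : {pred V -> R^o} :=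
  [pred a | `[<exists s : seq V, forall x, a x != 0 -> x \in s>]].

Lemma fin_suppP a :
  reflect (exists s : seq V, forall x, a x != 0 -> x \in s) (a \in fin_supp).
Proof. exact: asboolP. Qed.

Fact fin_supp_closed : submod_closed fin_supp.
Proof.
split=> [|k a b /fin_suppP[s sa] /fin_suppP[t tb]]; apply/fin_suppP.
  by exists [::] => x; rewrite eqxx.
exists (s ++ t) => x; rewrite mem_cat -[_ x]/(k *: a x + b x).
have [->|/sa -> //] := eqVneq (a x) 0.
by rewrite scaler0 add0r => /tb ->; rewrite orbT.
Qed.

HB.instance Definition _ :=
  GRing.isSubmodClosed.Build R (V -> R^o) fin_supp fin_supp_closed.

Lemma sum_supp_eq (F : V -> V) (s t : seq V) : uniq s -> uniq t ->
  (forall x, F x != 0 -> x \in s) -> (forall x, F x != 0 -> x \in t) ->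
  \sum_(x <- s) F x = \sum_(x <- t) F x.
Proof.
move=> us ut sF tF.
have sumE r : \sum_(x <- r) F x = \sum_(x <- [seq x <- r | F x != 0]) F x.
  rewrite big_filter (bigID (fun x => F x != 0)) /= [X in _ + X]big1 ?addr0 //.
  by move=> x /negbNE/eqP.
rewrite sumE [RHS]sumE; apply: perm_big; apply: uniq_perm.
- exact: filter_uniq.
- exact: filter_uniq.
- by move=> x; rewrite !mem_filter; case: eqP => //= /eqP Fx; rewrite sF // tF.
Qed.

(** The cover evaluates formal linear combinations; the indicator function of [y] is sent to [y]. *)
Lemma free_cover :
  exists t : {linear submodule fin_supp -> V}, forall y, exists x, t x = y.
Proof.
have /choice[supp suppP] : forall a : submodule fin_supp, exists s : seq V,
    uniq s /\ forall x, val a x != 0 -> x \in s.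
  move=> a; have /fin_suppP[s sa] := valP a; exists (undup s).
  by split=> [|x]; rewrite ?undup_uniq // mem_undup; exact: sa.
pose t a := \sum_(x <- supp a) (val a x : R) *: x.
have tE a s : uniq s -> (forall x, val a x != 0 -> x \in s) ->
    t a = \sum_(x <- s) (val a x : R) *: x.
  move=> us sa; have [ua aP] := suppP a; apply: sum_supp_eq => // x.
  - by have [->|/aP] := eqVneq (val a x) 0; rewrite ?scale0r ?eqxx.
  - by have [->|/sa] := eqVneq (val a x) 0; rewrite ?scale0r ?eqxx.
have tL : linear t.
  (* Summing over one list containing all three supports makes linearity a termwise check. *)
  move=> k a b; pose s := undup (supp (k *: a + b) ++ supp a ++ supp b).
  have sP c : supp c = supp (k *: a + b) \/ supp c = supp a \/ supp c = supp b ->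
      forall x, val c x != 0 -> x \in s.
    move=> cP x /(suppP c).2; rewrite mem_undup !mem_cat.
    by case: cP => [->|[->|->]] ->; rewrite ?orbT.
  have us := undup_uniq (supp (k *: a + b) ++ supp a ++ supp b).
  rewrite !(@tE _ s) //; try by apply: sP; auto.
  rewrite scaler_sumr -big_split; apply: eq_bigr => x _ /=.
  by rewrite scalerA -scalerDl.
exists (linear_of tL) => y.
pose d : V -> R^o := fun x => if x == y then 1 else 0.
have dP : d \in fin_supp.
  apply/fin_suppP; exists [:: y] => x; rewrite /d inE.
  by case: (x == y); rewrite ?eqxx.
exists (Submodule dP); rewrite -[linear_of tL _]/(t _).
rewrite (@tE _ [:: y]) //=; first by rewrite big_seq1 /d eqxx scale1r.
by move=> x; rewrite /d inE; case: (x == y); rewrite ?eqxx.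
Qed.
End Free.

(** A section of the free cover of [P], composed with [i], gives [S] finitely supported coordinates
    that separate its elements. *)
Lemma hereditary_projective_inj (R : pzRingType) (S P : lmodType R)
    (i : {linear S -> P}) :
  left_hereditary R -> projective P -> injective i -> projective S.
Proof.
move=> hered projP i_inj; have [t t_surj] := free_cover P.
have [s ts] := projP _ _ t idfun t_surj.
have cL (y : P) : linear (fun x => val (s (i x)) y : R^o).
  by move=> a u v; rewrite !linearP.
pose c y : {linear S -> R^o} := linear_of (cL y).
apply: (@coordinate_projective _ _ _ c) => // x.
  by have /fin_suppP[q qP] := valP (s (i x)); exists q.
move=> cx0; apply: i_inj; rewrite linear0 -[i x]ts.
suff -> : s (i x) = 0 by rewrite linear0.
by apply: val_inj; apply/funext => y; exact: cx0.
Qed.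

(** The image of [f] is a submodule of [F], hence projective, and [f] splits onto it. *)
Lemma hereditary_split (R : pzRingType) (U F : lmodType R) (f : {linear U -> F}) :
  left_hereditary R -> projective F ->
  exists (P : lmodType R) (p : {linear U -> P}) (s : {linear P -> U}),
    [/\ projective P, cancel s p & forall x, p x = 0 <-> f x = 0].
Proof.
move=> hered projF.
have projI : projective (submodule (im f)).
  by apply: (@hereditary_projective_inj _ _ _ val) => //; exact: val_inj.
have [p [s [psK pE]]] := im_split projI.
exists (submodule (im f)), p, s; split=> // x; rewrite -pE.
by split=> [->|px0]; [rewrite linear0|apply: val_inj; rewrite px0].
Qed.

(** * Kernels and the projections of a direct sum *)

Lemma kerE (R : pzRingType) (A B : lmodType R) (f : {linear A -> B}) x :
  (x \in ker f) = (f x == 0).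
Proof. by []. Qed.

Lemma submodB (R : pzRingType) (V : lmodType R) (M : submodClosed V) x y :
  x \in M -> y \in M -> x - y \in M.
Proof. by move=> xM yM; rewrite -scaleN1r rpredD // rpredZ. Qed.

(** Components in [M] are chosen pointwise; the defect of linearity lies in both [M] and [N], hence
    vanishes. *)
Lemma direct_sum_proj (R : pzRingType) (V : lmodType R) (M N : submodClosed V) :
  direct_sum M N ->
  exists p : {linear V -> V}, forall x, p x \in M /\ x - p x \in N.
Proof.
move=> [MNT MN0].
have /choice[p pP] : forall x, exists y, y \in M /\ x - y \in N.
  by move=> x; have [m [n [mM nN ->]]] := MNT x; exists m; rewrite addrC addKr.
have pL : linear p.
  move=> a x y; apply/subr0_eq/MN0.
    by rewrite submodB ?rpredD ?rpredZ //; exact: (pP _).1.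
  have -> : p (a *: x + y) - (a *: p x + p y) =
      a *: (x - p x) + (y - p y) - (a *: x + y - p (a *: x + y)).
    by rewrite scalerBr addrACA -opprD opprB [RHS]addrC addrA subrK.
  apply: submodB (pP _).2; rewrite rpredD //; last exact: (pP _).2.
  by rewrite rpredZ //; exact: (pP _).2.
by exists (linear_of pL) => x; exact: pP.
Qed.

(** * Stable isomorphisms over a hereditary ring *)

Section StableIso.
Variables (L : pzRingType) (A B : lmodType L) (f : {linear A -> B}).
Hypothesis hered : left_hereditary L.

Section Necessity.
(** Here [g] represents a stable inverse of [f]; [gfE] and [fgE] spell out the two stable
    equivalences with identities. *)
Variables (g : {linear B -> A}) (P P' : lmodType L).
Variables (u : {linear A -> P}) (v : {linear P -> A}).
Variables (s : {linear B -> P'}) (t : {linear P' -> B}).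
Hypothesis projP : projective P.
Hypothesis projP' : projective P'.
Hypothesis gfE : forall a, a - g (f a) = v (u a).
Hypothesis fgE : forall b, b - f (g b) = t (s b).

Lemma ker_vuK a : f a = 0 -> v (u a) = a.
Proof. by move=> fa0; rewrite -gfE fa0 linear0 subr0. Qed.

Lemma ker_projective : projective (submodule (ker f)).
Proof.
apply: (@hereditary_projective_inj _ _ _ (u \o val) hered projP).
move=> x y uxy; apply: val_inj.
have fval (z : submodule (ker f)) : f (val z) = 0 by apply/eqP; rewrite -kerE (valP z).
by rewrite -(ker_vuK (fval x)) -(ker_vuK (fval y)); congr (v _).
Qed.

Lemma ker_summand : direct_summand (ker f).
Proof.
have phiL : linear (fun p : P => (s (f (v p)), p - u (v p))).
  by move=> a x y; rewrite !linearP; congr (_, _); rewrite /= scalerDr addrACA.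
pose phi : {linear P -> (P' * P)%type} := linear_of phiL.
have phiE p : phi p = (s (f (v p)), p - u (v p)) by [].
(* The second component gives [p = u (v p)], so [gfE] at [v p] yields [g (f (v p)) = 0]; then [fgE]
   at [f (v p)] and the first component finish. *)
have phi0 p : phi p = 0 -> f (v p) = 0.
  rewrite phiE => -[sfv0 /subr0_eq uvK].
  have gfv0 : g (f (v p)) = 0.
    by apply/eqP; rewrite -oppr_eq0 -(addKr (v p) (- _)) gfE -uvK addNr.
  by have := fgE (f (v p)); rewrite gfv0 sfv0 !linear0 addr0.
have [F [p [r [_ rpK pE]]]] := hereditary_split phi hered (projective_prod projP' projP).
have fv0 x : f (v (x - r (p x))) = 0.
  by apply/phi0/pE; rewrite linearB rpK subrr.
(* The map [x - r (p x)] projects [P] onto the kernel of [phi]. Thus [rho] takes values in [ker f]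
   and fixes it, and its own kernel is the complement. *)
pose rho : {linear A -> A} := v \o (u \- (r \o (p \o u))).
have rhoE a : rho a = v (u a - r (p (u a))) by [].
have rhoK a : f a = 0 -> rho a = a.
  move=> fa0; rewrite rhoE.
  suff -> : p (u a) = 0 by rewrite linear0 subr0 ker_vuK.
  by apply/pE; rewrite phiE ker_vuK // fa0 linear0 subrr.
have frho a : f (rho a) = 0 by exact: fv0.
exists (ker rho : submodClosed A); split=> [x|x].
  exists (rho x), (x - rho x); rewrite !kerE frho linearB (rhoK (rho x)) //.
  by rewrite subrr !eqxx addrC subrK.
by rewrite !kerE => /eqP/rhoK-> /eqP.
Qed.

Lemma codomain_decomposition : exists M Q : submodClosed B,
  [/\ direct_sum M Q, projective (submodule Q) &
      forall b : B, b \in M -> exists a : A, f a = b].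
Proof.
have [F [p [r [projF rpK pE]]]] := hereditary_split s hered projP'.
exists (ker s : submodClosed B), (im r : submodClosed B); split.
- split=> [x|x]; last first.
    by rewrite kerE => /eqP/pE px0 /imP[y yx]; rewrite -yx -[y]rpK yx px0 linear0.
  exists (x - r (p x)), (r (p x)); split; last by rewrite subrK.
    by rewrite kerE; apply/eqP/pE; rewrite linearB rpK subrr.
  by apply/imP; exists (p x).
(* Since [r] is a section of [p], the map [p] embeds the image of [r] in [F]. *)
- apply: (@hereditary_projective_inj _ _ _ (p \o val) hered projF).
  move=> x y pxy; apply: val_inj.
  have /imP[x' x'E] := valP x; have /imP[y' y'E] := valP y.
  by move: pxy; rewrite /= -[submodule_val x]x'E -[submodule_val y]y'E !rpK => ->.
- move=> b; rewrite kerE => /eqP sb0; exists (g b).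
  by apply/esym/subr0_eq; rewrite fgE sb0 linear0.
Qed.
End Necessity.

Lemma stable_iso_sufficient (N : submodClosed A) (M Q : submodClosed B) :
  direct_sum (ker f) N -> projective (submodule (ker f)) ->
  direct_sum M Q -> projective (submodule Q) ->
  (forall b : B, b \in M -> exists a : A, f a = b) ->
  stable_iso (stable_class f).
Proof.
move=> dsKN projK dsMQ projQ Mf.
have [pK pKP] := direct_sum_proj dsKN; have [pM pMP] := direct_sum_proj dsMQ.
have fK a : f (pK a) = 0 by apply/eqP; rewrite -kerE; exact: (pKP a).1.
have N_inj n n' : n \in N -> n' \in N -> f n = f n' -> n = n'.
  move=> nN n'N fnn'; apply/subr0_eq/dsKN.2; last exact: submodB.
  by rewrite kerE linearB fnn' subrr.
(* Subtracting the kernel component moves a preimage into [N] without changing its image. *)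
have /choice[g gP] : forall b, exists n, n \in N /\ f n = pM b.
  move=> b; have [a fa] := Mf _ (pMP b).1; exists (a - pK a).
  by split; [exact: (pKP a).2|rewrite linearB fK subr0].
have gL : linear g.
  move=> a x y; apply: N_inj; first exact: (gP _).1.
    by rewrite rpredD ?rpredZ //; exact: (gP _).1.
  by rewrite linearP !(gP _).2 linearP.
pose g' : {linear B -> A} := linear_of gL.
have fg b : f (g' b) = pM b by exact: (gP b).2.
exists (stable_class g'); rewrite !stable_compE; split; apply/stable_classP/stable_equiv_sym.
(* The map [d] factors through its own image. An element of [A] is determined by its component in
   [ker f] and its value under [f], and [f] maps the image of [d] into [Q]; so this image embeds in
   [ker f * Q]. *)
- pose d : {linear A -> A} := idfun \- (g' \o f).
  have dE a : d a = a - g' (f a) by [].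
  have [|d' d'E] := corestrict_linear (S := im d) (f := d).
    by move=> x; apply/imP; exists x.
  exists (submodule (im d)), d', val; split; last by move=> x; exact/esym/d'E.
  have fd a : f (d a) \in Q by rewrite dE linearB fg; exact: (pMP _).2.
  have [|k kE] := corestrict_linear (S := ker f)
      (f := pK \o val : {linear submodule (im d) -> A}).
    by move=> x; exact: (pKP _).1.
  have [|l lE] := corestrict_linear (S := Q)
      (f := f \o val : {linear submodule (im d) -> B}).
    by move=> x /=; have /imP[y <-] := valP x.
  have klL : linear (fun x => (k x, l x)) by move=> a x y; rewrite !linearP.
  apply: (@hereditary_projective_inj _ _ _ (linear_of klL) hered).
    exact: projective_prod.
  move=> x y [kxy lxy]; apply: val_inj.
  have pKxy : pK (val x) = pK (val y) by rewrite -[LHS]kE kxy kE.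
  have fxy : f (val x) = f (val y) by rewrite -[LHS]lE lxy lE.
  rewrite -[LHS](subrK (pK (val x))) -[RHS](subrK (pK (val y))) pKxy; congr (_ + _).
  rewrite -{1}pKxy; apply: N_inj; try exact: (pKP _).2.
  by rewrite !linearB !fK fxy.
- have [|q qE] := corestrict_linear (S := Q)
      (f := idfun \- pM : {linear B -> B}).
    by move=> x; exact: (pMP x).2.
  by exists (submodule Q), q, val; split=> // b; rewrite -[RHS]/(val (q b)) qE /= fg.
Qed.
End StableIso.

Theorem theorem5p14 (L : pzRingType) (A B : lmodType L) (f : {linear A -> B}) :
  left_hereditary L ->
  stable_iso (stable_class f) <->
  ((projective (submodule (ker f)) /\ direct_summand (ker f)) /\
   exists M Q : submodClosed B,
     [/\ direct_sum M Q, projective (submodule Q) &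
         forall b : B, b \in M -> exists a : A, f a = b]).
Proof.
move=> hered; split=> [[c [cf fc]]|[[projK [N dsKN]] [M [Q [dsMQ projQ Mf]]]]].
  move: cf fc; rewrite -(stable_reprK c); move: (repr c) => g.
  rewrite !stable_compE.
  move=> /stable_classP/stable_equiv_sym[P [u [v [projP gfE]]]].
  move=> /stable_classP/stable_equiv_sym[P' [s [t [projP' fgE]]]].
  split; first split.
  - exact: (ker_projective hered projP gfE).
  - exact: (ker_summand hered projP projP' gfE fgE).
  - exact: (codomain_decomposition hered projP' fgE).
exact: (stable_iso_sufficient hered dsKN projK dsMQ projQ Mf).
Qed.
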